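(* Let $I\subset\mathbb{R}$ be an interval, let $f:I\to\mathbb{R}$ be a convex function, let $[a,b]\subset I$, and let $\mathbf{x}=(x_1,\dots,x_n)\in[a,b]^n$ with $x_1\le x_2\le\dots\le x_n$. Let $\mathbf{p}=(p_1,\dots,p_n)$ be a real $n$-tuple with $0\le\sum_{j=1}^{i}p_j\le 1$ for $i=1,\dots,n$ and $\sum_{i=1}^{n}p_i=1$. Set $$m_i=\frac{\sum_{j=1}^{i}p_j}{i/n},\qquad \overline{m}_i=\frac{\sum_{j=i}^{n}p_j}{(n-i+1)/n},\qquad i=1,\dots,n,$$ $$m^{\ast}=\min_{1\le i\le n}\{m_i,\overline{m}_i\},\qquad M^{\ast}=\max_{1\le i\le n}\{m_i,\overline{m}_i\}.$$ Then $$m^{\ast}\left[\sum_{i=1}^{n}\frac{f(x_i)}{n}-f\left(\frac{\sum_{i=1}^{n}x_i}{n}\right)\right]\le J_n(f,\mathbf{x},\mathbf{p})\le M^{\ast}\left[\sum_{i=1}^{n}\frac{f(x_i)}{n}-f\left(\frac{\sum_{i=1}^{n}x_i}{n}\right)\right].$$ If $p_i\ge 0$ for $i=1,\dots,n$, then $$\min_{1\le i\le n}\{p_i\}\left[\sum_{i=1}^{n}f(x_i)-nf\left(\frac{\sum_{i=1}^{n}x_i}{n}\right)\right]\le m^{\ast}\left[\sum_{i=1}^{n}\frac{f(x_i)}{n}-f\left(\frac{\sum_{i=1}^{n}x_i}{n}\right)\right]\le J_n(f,\mathbf{x},\mathbf{p})$$ $$\le M^{\ast}\left[\sum_{i=1}^{n}\frac{f(x_i)}{n}-f\left(\frac{\sum_{i=1}^{n}x_i}{n}\right)\right]\le\max_{1\le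 i\le n}\{p_i\}\left[\sum_{i=1}^{n}f(x_i)-nf\left(\frac{\sum_{i=1}^{n}x_i}{n}\right)\right].$$
   Context: The Jensen functional is $J_n(f,\mathbf{x},\mathbf{p})=\sum_{i=1}^{n}p_if(x_i)-f\left(\sum_{i=1}^{n}p_ix_i\right)$. In the first part the $p_i$ may be negative, subject to the stated partial-sum conditions. *)

(* Defs.v *)
From mathcomp Require Import all_boot all_order all_algebra.
From mathcomp Require Import classical_sets set_interval reals.
From mathcomp Require Import num_normedtype convex.

Set Implicit Arguments.
Unset Strict Implicit.
Unset Printing Implicit Defensive.

Import Order.TTheory GRing.Theory Num.Theory.

Local Open Scope ring_scope.

(* A nonempty tuple of length N = n.+1 is a function on 'I_n.+1; the 0-based
   index i : 'I_n.+1 stands for the usual 1-based index i.+1. *)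

Definition jensen (R : realType) (n : nat) (f : R -> R)
    (x p : 'I_n.+1 -> R) : R :=
  \sum_i p i * f (x i) - f (\sum_i p i * x i).

Definition unif_jensen (R : realType) (n : nat) (f : R -> R)
    (x : 'I_n.+1 -> R) : R :=
  \sum_i f (x i) / n.+1%:R - f ((\sum_i x i) / n.+1%:R).

(* The default value of the iterated min (resp. max) is one of its terms, so
   these are the exact minimum and maximum of the family F. *)
Definition fam_min (R : realType) (n : nat) (F : 'I_n.+1 -> R) : R :=
  \big[Num.min/F ord0]_i F i.

Definition fam_max (R : realType) (n : nat) (F : 'I_n.+1 -> R) : R :=
  \big[Num.max/F ord0]_i F i.

Definition head_sum (R : realType) (n : nat) (p : 'I_n.+1 -> R)
    (i : 'I_n.+1) : R :=
  \sum_(j < n.+1 | (j <= i)%N) p j.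

Definition tail_sum (R : realType) (n : nat) (p : 'I_n.+1 -> R)
    (i : 'I_n.+1) : R :=
  \sum_(j < n.+1 | (i <= j)%N) p j.

Definition head_ratio (R : realType) (n : nat) (p : 'I_n.+1 -> R)
    (i : 'I_n.+1) : R :=
  head_sum p i / (i.+1%:R / n.+1%:R).

(* With the 1-based index i.+1 and length N = n.+1, the number of terms
   N - i.+1 + 1 of the tail sum is n.+1 - i. *)
Definition tail_ratio (R : realType) (n : nat) (p : 'I_n.+1 -> R)
    (i : 'I_n.+1) : R :=
  tail_sum p i / ((n.+1 - i)%:R / n.+1%:R).

Definition mstar (R : realType) (n : nat) (p : 'I_n.+1 -> R) : R :=
  fam_min (fun i => Num.min (head_ratio p i) (tail_ratio p i)).

Definition Mstar (R : realType) (n : nat) (p : 'I_n.+1 -> R) : R :=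
  fam_max (fun i => Num.max (head_ratio p i) (tail_ratio p i)).

(* Main.v *)
(* Both bounds are instances of one inequality, in which the barycentre of the
   other system is inserted as an additional atom.  If the weights q_i at the
   sorted points x_i have nonnegative head and tail sums, w >= 0 is a weight
   at d, and the whole system has mass W and barycentre c, then
   W f(c) <= sum_i q_i f(x_i) + w f(d).  Writing N for the number of points, u
   for their mean and v for sum_i p_i x_i, the lower bound is
   q = p - m*/N, w = m*, d = u, W = 1, c = v, and the upper bound is
   q = M*/N - p, w = 1, d = v, W = M*, c = u; the definitions of m* and M* say
   exactly that the head and tail sums of these q are nonnegative. *)

Require Import Defs.
From mathcomp Require Import all_boot all_order all_algebra.
From mathcomp Require Import classical_sets set_interval reals.
From mathcomp Require Import num_normedtype convex.
From mathcomp Require Import interval_inference zify ring lra.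

Set Implicit Arguments.
Unset Strict Implicit.
Unset Printing Implicit Defensive.

Import Order.TTheory GRing.Theory Num.Theory.

Local Open Scope classical_set_scope.
Local Open Scope ring_scope.

(** * Support lines at finitely many points *)

(** Either list may be empty: when it is applied to slopes, one side may contain no points. *)
Lemma finite_separation (R : realDomainType) (l u : seq R) :
  {in l & u, forall s t, s <= t} ->
  exists c, {in l, forall s, s <= c} /\ {in u, forall t, c <= t}.
Proof.
elim: l => [_|s l IH lu].
  elim: u => [|t u [c [_ cu]]]; first by exists 0.
  exists (Num.min t c); split=> // v; rewrite inE => /predU1P[->|/cu cv].
    by rewrite ge_min lexx.
  by rewrite ge_min cv orbT.
have [|c [lc cu]] := IH.
  by move=> v t vl tu; apply: lu; rewrite // inE vl orbT.
exists (Num.max s c); split=> [v|t tu].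
  rewrite inE => /predU1P[->|/lc vc]; first by rewrite le_max lexx.
  by rewrite le_max vc orbT.
by rewrite ge_max cu // andbT lu // mem_head.
Qed.

(** Clearing the denominators admits the degenerate chord [y = z]. *)
Definition chord_convex (R : numDomainType) (A : interval R) (f : R -> R) : Prop :=
  {in A & &, forall y c z, y <= c -> c <= z ->
    (z - y) * f c <= (z - c) * f y + (c - y) * f z}.

Lemma convex_function_chord (R : realType) (I : set R) (f : R -> R) (a b : R) :
  convex_function (I : set R^o) f -> `[a, b] `<=` I ->
  chord_convex `[a, b] f.
Proof.
move=> hf hab y c z yab _ zab yc cz.
have [zy|yz] := eqVneq y z.
  have -> : c = z by apply/eqP; rewrite eq_le cz -zy.
  by rewrite zy !subrr !mul0r addr0.
have zy0 : 0 < z - y by rewrite subr_gt0 lt_neqAle yz; apply: le_trans cz.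
have t0 : 0 <= (z - c) / (z - y) by rewrite divr_ge0 ?(ltW zy0) // subr_ge0.
have t1 : (z - c) / (z - y) <= 1 by rewrite ler_pdivrMr // mul1r lerD2l lerN2.
have yI : y \in I by rewrite inE; apply: hab.
have zI : z \in I by rewrite inE; apply: hab.
have zy : z - y != 0 by rewrite gt_eqF.
have : f ((z - c) / (z - y) * y + (1 - (z - c) / (z - y)) * z)
    <= (z - c) / (z - y) * f y + (1 - (z - c) / (z - y)) * f z.
  exact: (hf (Itv01 t0 t1) y z yI zI).
have -> : (z - c) / (z - y) * y + (1 - (z - c) / (z - y)) * z = c by field.
have -> : (z - c) / (z - y) * f y + (1 - (z - c) / (z - y)) * f z
  = ((z - c) * f y + (c - y) * f z) / (z - y) by field.
by rewrite ler_pdivlMr // mulrC.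
Qed.

(* Supporting only finitely many points lets [c] be an endpoint of [A], where a
   convex function need not have a support line. *)
Lemma chord_convex_support (R : realFieldType) (A : interval R) (f : R -> R)
    (s : seq R) (c : R) :
  chord_convex A f -> c \in A -> {subset s <= A} ->
  exists k, {in s, forall y, f c + k * (y - c) <= f y}.
Proof.
move=> fA cA sA; pose slope y := (f y - f c) / (y - c).
have slopel y k : y < c -> (slope y <= k) = (f c + k * (y - c) <= f y).
  by move=> yc; rewrite /slope ler_ndivrMr ?subr_lt0 // lerBrDl.
have sloper y k : c < y -> (k <= slope y) = (f c + k * (y - c) <= f y).
  by move=> cy; rewrite /slope ler_pdivlMr ?subr_gt0 // lerBrDl.
(* Chord convexity puts every slope from the left of [c] below every slope from the right; any
   number between them is the slope of a support line. *)
have [|k [lk ku]] := @finite_separation _ [seq slope y | y <- s & y < c]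
    [seq slope y | y <- s & c < y].
  move=> _ _ /mapP[y + ->] /mapP[z + ->].
  rewrite !mem_filter => /andP[yc /sA yA] /andP[cz /sA zA].
  have := fA y c z yA cA zA (ltW yc) (ltW cz).
  rewrite slopel // /slope mulrAC -lerBrDl ler_pdivrMr ?subr_gt0 //.
  lra.
exists k => y ys; case: (ltgtP y c) => [yc|cy|->].
- by rewrite -slopel // lk // map_f // mem_filter yc.
- by rewrite -sloper // ku // map_f // mem_filter cy.
- by rewrite subrr mulr0 addr0.
Qed.

(** * Partial sums, Abel summation and Jensen's inequality with signed weights *)

Section PartialSums.
Variables (R : realType) (n : nat).
Implicit Types (p q h : 'I_n.+1 -> R) (i : 'I_n.+1).

Lemma head_sum_nat q i :
  head_sum q i = \sum_(0 <= j < i.+1) q (inord j).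
Proof.
rewrite big_mkord (big_ord_widen n.+1 (fun j => q (inord j))) //.
by apply: eq_big => j //; rewrite inord_val.
Qed.

Lemma tail_sum_rev q i : tail_sum q i = head_sum (q \o @rev_ord _) (rev_ord i).
Proof.
rewrite /tail_sum (reindex_inj rev_ord_inj) /=; apply: eq_bigl => j /=.
by have := ltn_ord i; have := ltn_ord j; lia.
Qed.

(** One shape serves both bounds: [u = 1], [v = m*/N] gives p - m*/N, and [u = -1], [v = -M*/N]
    gives M*/N - p. *)
Lemma head_sum_affine u v q i :
  head_sum (fun j => u * q j - v) i = u * head_sum q i - v * i.+1%:R.
Proof.
rewrite /head_sum sumrB -mulr_sumr; congr (_ - _).
transitivity (\sum_(j < i.+1) v); last by rewrite sumr_const card_ord mulr_natr.
exact/esym/(big_ord_widen n.+1 (fun=> v))/ltn_ord.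
Qed.

Lemma tail_sum_affine u v q i :
  tail_sum (fun j => u * q j - v) i = u * tail_sum q i - v * (n.+1 - i)%:R.
Proof.
rewrite !tail_sum_rev (head_sum_affine u v (q \o @rev_ord _)) /=.
by congr (_ - _ * _%:R); have := ltn_ord i; lia.
Qed.

Lemma abel_head q h :
  (forall i, 0 <= head_sum q i) -> (forall i, 0 <= h i) ->
  (forall i j : 'I_n.+1, (i <= j)%N -> h j <= h i) -> 0 <= \sum_i q i * h i.
Proof.
move=> q0 h0 hle.
(* Summation by parts as an induction: passing from [k] to [k + 1] lowers the factor of a
   nonnegative head sum. *)
have abel k : (k < n.+1)%N -> (\sum_(0 <= j < k.+1) q (inord j)) * h (inord k)
    <= \sum_(0 <= j < k.+1) q (inord j) * h (inord j).
  elim: k => [|k IH] kn; first by rewrite !big_nat1.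
  rewrite big_nat_recr //= [X in _ <= X]big_nat_recr //= mulrDl lerD2r.
  apply: le_trans (IH (ltnW kn)); apply: ler_wpM2l.
    by have := q0 (inord k); rewrite head_sum_nat inordK // ltnW.
  by apply: hle; rewrite !inordK // ltnW.
have -> : \sum_i q i * h i = \sum_(0 <= j < n.+1) q (inord j) * h (inord j).
  by rewrite big_mkord; apply: eq_bigr => i _; rewrite inord_val.
apply: le_trans (abel n (ltnSn n)); apply: mulr_ge0 => //.
by have := q0 ord_max; rewrite head_sum_nat.
Qed.

Lemma abel_tail q h :
  (forall i, 0 <= tail_sum q i) -> (forall i, 0 <= h i) ->
  (forall i j : 'I_n.+1, (i <= j)%N -> h i <= h j) -> 0 <= \sum_i q i * h i.
Proof.
move=> q0 h0 hle; rewrite (reindex_inj rev_ord_inj) /=.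
apply: (@abel_head (q \o @rev_ord _) (h \o @rev_ord _)) => [i|i|i j ij] //=.
  by rewrite -(rev_ordK i) -tail_sum_rev.
by apply: hle => /=; have := ltn_ord j; lia.
Qed.

(* Minus a support line at [c], [f] is nonnegative, nonincreasing up to [c] and
   nondecreasing from [c] on, so Abel summation applies to the points left of
   [c] with the head sums and to those right of [c] with the tail sums. *)
Lemma signed_jensen (A : interval R) (f : R -> R) (x q : 'I_n.+1 -> R)
    (c d w W : R) :
  chord_convex A f -> (forall i, x i \in A) -> c \in A -> d \in A ->
  (forall i j : 'I_n.+1, (i <= j)%N -> x i <= x j) ->
  (forall i, 0 <= head_sum q i) -> (forall i, 0 <= tail_sum q i) ->
  0 <= w -> \sum_i q i + w = W -> \sum_i q i * x i + w * d = W * c ->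
  W * f c <= \sum_i q i * f (x i) + w * f d.
Proof.
move=> fA xA cA dA xle hq tq w0 qW qc.
have [|k kP] := @chord_convex_support _ A f (d :: codom x) c fA cA.
  by move=> y; rewrite inE => /predU1P[->|/codomP[i ->]].
pose g y := f y - f c - k * (y - c).
have g0 i : 0 <= g (x i).
  by have := kP (x i); rewrite inE codom_f orbT => /(_ isT); rewrite /g; lra.
have gd : 0 <= g d by have := kP d (mem_head _ _); rewrite /g; lra.
(* Since [g c = 0], the chord inequality reads (c - x_i) g(x_j) <= (c - x_j) g(x_i). Dropping (x_j -
   x_i) g(x_j) >= 0 on the left and dividing by c - x_j gives the claim. *)
have gl (i j : 'I_n.+1) : x j <= c -> (i <= j)%N -> g (x j) <= g (x i).
  move=> jc ij; have := fA _ _ _ (xA i) (xA j) cA (xle _ _ ij) jc.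
  have := g0 j; have := g0 i; have := xle _ _ ij.
  have [->|ne] := eqVneq (x j) c; first by rewrite /g; lra.
  have c0 : 0 < c - x j by rewrite subr_gt0 lt_neqAle ne.
  move=> ixj gi gj ch; rewrite -(ler_pM2l c0).
  have : 0 <= (x j - x i) * g (x j) by rewrite mulr_ge0 // subr_ge0.
  by move: ch; rewrite /g; lra.
have gr (i j : 'I_n.+1) : c <= x i -> (i <= j)%N -> g (x i) <= g (x j).
  move=> ci ij; have := fA _ _ _ cA (xA i) (xA j) ci (xle _ _ ij).
  have := g0 j; have := g0 i; have := xle _ _ ij.
  have [->|ne] := eqVneq (x i) c; first by rewrite /g; lra.
  have c0 : 0 < x i - c by rewrite subr_gt0 lt_neqAle eq_sym ne.
  move=> ixj gi gj ch; rewrite -(ler_pM2l c0).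
  have : 0 <= (x j - x i) * g (x i) by rewrite mulr_ge0 // subr_ge0.
  by move: ch; rewrite /g; lra.
(* Extended by 0 past [c], the left part of [g] stays nonnegative and nonincreasing over all
   indices; the right part is symmetric. *)
have left0 : 0 <= \sum_i q i * (if x i <= c then g (x i) else 0).
  apply: abel_head => // [i|i j ij]; first by case: ifP.
  case: ifPn => jc; first by rewrite (le_trans (xle _ _ ij) jc) gl.
  by case: ifP.
have right0 : 0 <= \sum_i q i * (if x i <= c then 0 else g (x i)).
  apply: abel_tail => // [i|i j ij]; first by case: ifP.
  case: ifPn => ic; first by case: ifP.
  have ci : c < x i by rewrite ltNge.
  by rewrite [x j <= c]leNgt (lt_le_trans ci (xle _ _ ij)) /= gr // ltW.
have : 0 <= \sum_i q i * g (x i) + w * g d.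
  rewrite addr_ge0 ?mulr_ge0 //; move: (addr_ge0 left0 right0).
  rewrite -big_split /=; congr (0 <= _); apply: eq_bigr => i _.
  by case: ifP => _; rewrite mulr0 ?addr0 ?add0r.
(* By the mass and barycentre conditions the slope terms cancel and the support line contributes
   exactly [W * f c]. *)
have -> : \sum_i q i * g (x i) =
    \sum_i q i * f (x i) - k * \sum_i q i * x i - (f c - k * c) * \sum_i q i.
  rewrite !mulr_sumr -!sumrB; apply: eq_bigr => i _; rewrite /g; ring.
move: qW qc; set Q := \sum_i q i; set X := \sum_i q i * x i => qW qc.
have -> : Q = W - w by rewrite -qW addrK.
have -> : X = W * c - w * d by rewrite -qc addrK.
rewrite /g; lra.
Qed.

(** * The ratios as sign conditions on shifted weights *)

Lemma ler_ratio (v s : R) (k m : nat) : (0 < k)%N -> (0 < m)%N ->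
  (v <= s / (k%:R / m%:R)) = (0 <= s - v / m%:R * k%:R).
Proof.
move=> k0 m0; rewrite ler_pdivlMr ?divr_gt0 ?ltr0n // subr_ge0.
by rewrite mulrA mulrAC.
Qed.

Lemma ger_ratio (v s : R) (k m : nat) : (0 < k)%N -> (0 < m)%N ->
  (s / (k%:R / m%:R) <= v) = (0 <= v / m%:R * k%:R - s).
Proof.
move=> k0 m0; rewrite ler_pdivrMr ?divr_gt0 ?ltr0n // subr_ge0.
by rewrite mulrA mulrAC.
Qed.

Lemma fam_min_le (F : 'I_n.+1 -> R) i : fam_min F <= F i.
Proof. exact: bigmin_le. Qed.

Lemma le_fam_max (F : 'I_n.+1 -> R) i : F i <= fam_max F.
Proof. exact: le_bigmax. Qed.

Lemma le_fam_min (F : 'I_n.+1 -> R) v : (forall i, v <= F i) -> v <= fam_min F.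
Proof. by move=> vF; apply: le_bigmin. Qed.

Lemma fam_max_le (F : 'I_n.+1 -> R) v : (forall i, F i <= v) -> fam_max F <= v.
Proof. by move=> vF; apply: bigmax_le. Qed.

Lemma le_mstar p v :
  (forall i, v <= head_ratio p i) -> (forall i, v <= tail_ratio p i) ->
  v <= mstar p.
Proof. by move=> vh vt; apply: le_fam_min => i; rewrite le_min vh vt. Qed.

Lemma Mstar_le p v :
  (forall i, head_ratio p i <= v) -> (forall i, tail_ratio p i <= v) ->
  Mstar p <= v.
Proof. by move=> vh vt; apply: fam_max_le => i; rewrite ge_max vh vt. Qed.

Lemma tail_size_gt0 i : (0 < n.+1 - i)%N.
Proof. by rewrite subn_gt0. Qed.

Lemma head_sub_mstar_ge0 p i :
  0 <= head_sum (fun j => 1 * p j - mstar p / n.+1%:R) i.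
Proof.
rewrite head_sum_affine mul1r -ler_ratio //.
by apply: le_trans (fam_min_le _ i) _; rewrite ge_min lexx.
Qed.

Lemma tail_sub_mstar_ge0 p i :
  0 <= tail_sum (fun j => 1 * p j - mstar p / n.+1%:R) i.
Proof.
rewrite tail_sum_affine mul1r -ler_ratio ?tail_size_gt0 //.
by apply: le_trans (fam_min_le _ i) _; rewrite ge_min lexx orbT.
Qed.

Lemma head_Mstar_sub_ge0 p i :
  0 <= head_sum (fun j => -1 * p j - - (Mstar p / n.+1%:R)) i.
Proof.
rewrite head_sum_affine mulN1r mulNr opprK addrC -ger_ratio //.
by apply: le_trans (le_fam_max _ i); rewrite le_max lexx.
Qed.

Lemma tail_Mstar_sub_ge0 p i :
  0 <= tail_sum (fun j => -1 * p j - - (Mstar p / n.+1%:R)) i.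
Proof.
rewrite tail_sum_affine mulN1r mulNr opprK addrC -ger_ratio ?tail_size_gt0 //.
by apply: le_trans (le_fam_max _ i); rewrite le_max lexx orbT.
Qed.

(** The tail sum from [i] is 1 minus the head sum up to the preceding index; index 0 has no
    predecessor, and its tail is the whole sum. *)
Lemma tail_sum_ge0 p : (forall i, head_sum p i <= 1) -> \sum_i p i = 1 ->
  forall i, 0 <= tail_sum p i.
Proof.
move=> hp1 sp1 i; have [i0|i0] := posnP i.
  rewrite /tail_sum (eq_bigl xpredT) ?sp1 // => j.
  by rewrite i0.
have lei : (i.-1 < n.+1)%N by apply: leq_ltn_trans (leq_pred i) _.
have : head_sum p (Ordinal lei) + tail_sum p i = 1.
  rewrite -sp1 (bigID (fun j : 'I_n.+1 => (j < i)%N)) /=; congr (_ + _).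
    by apply: eq_bigl => j /=; lia.
  by apply: eq_bigl => j /=; lia.
by have := hp1 (Ordinal lei); lra.
Qed.

(** The weights may be negative, so Abel summation replaces convexity of the interval: tail sums
    against x_i - a, head sums against b - x_i. *)
Lemma mean_itv (a b : R) (x p : 'I_n.+1 -> R) :
  (forall i, x i \in `[a, b]) ->
  (forall i j : 'I_n.+1, (i <= j)%N -> x i <= x j) ->
  (forall i, 0 <= head_sum p i) -> (forall i, 0 <= tail_sum p i) ->
  \sum_i p i = 1 -> \sum_i p i * x i \in `[a, b].
Proof.
move=> xab xle hp tp p1; rewrite in_itv /=; apply/andP; split.
  have : 0 <= \sum_i p i * (x i - a).
    apply: abel_tail => // [i|i j ij]; last by rewrite lerD2r xle.
    by have := xab i; rewrite in_itv /= subr_ge0 => /andP[].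
  rewrite (eq_bigr _ (fun i _ => mulrBr (p i) (x i) a)).
  by rewrite sumrB -mulr_suml p1 mul1r subr_ge0.
have : 0 <= \sum_i p i * (b - x i).
  apply: abel_head => // [i|i j ij]; last by rewrite lerD2l lerN2 xle.
  by have := xab i; rewrite in_itv /= subr_ge0 => /andP[].
rewrite (eq_bigr _ (fun i _ => mulrBr (p i) b (x i))).
by rewrite sumrB -mulr_suml p1 mul1r subr_ge0.
Qed.

Lemma unif_jensenE f (x : 'I_n.+1 -> R) :
  \sum_i f (x i) - n.+1%:R * f ((\sum_i x i) / n.+1%:R)
  = n.+1%:R * unif_jensen f x.
Proof.
rewrite /unif_jensen -mulr_suml mulrBr; congr (_ - _).
by rewrite mulrC divfK.
Qed.

End PartialSums.

Theorem theorem6 (R : realType) (I : set R) (f : R -> R) (a b : R)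
    (n : nat) (x p : 'I_n.+1 -> R)
    (hI : is_interval I)
    (hf : convex_function (I : set R^o) f)
    (hab : `[a, b] `<=` I)
    (hx : forall i : 'I_n.+1, `[a, b]%classic (x i))
    (hxs : forall i j : 'I_n.+1, (i <= j)%N -> x i <= x j)
    (hp : forall i : 'I_n.+1, 0 <= head_sum p i <= 1)
    (hp1 : \sum_(i < n.+1) p i = 1) :
  (mstar p * unif_jensen f x <= jensen f x p
   /\ jensen f x p <= Mstar p * unif_jensen f x)
  /\
  ((forall i : 'I_n.+1, 0 <= p i) ->
   [/\ fam_min p * (\sum_(i < n.+1) f (x i)
                    - n.+1%:R * f ((\sum_(i < n.+1) x i) / n.+1%:R))
         <= mstar p * unif_jensen f x,
       mstar p * unif_jensen f x <= jensen f x p,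
       jensen f x p <= Mstar p * unif_jensen f x &
       Mstar p * unif_jensen f x
         <= fam_max p * (\sum_(i < n.+1) f (x i)
                         - n.+1%:R * f ((\sum_(i < n.+1) x i) / n.+1%:R))]).
Proof.
have fab := convex_function_chord hf hab.
have xab i : x i \in `[a, b] by have := hx i.
have hp0 i : 0 <= head_sum p i by have /andP[] := hp i.
have tp0 : forall i, 0 <= tail_sum p i.
  by apply: tail_sum_ge0 => // i; have /andP[] := hp i.
pose N : R := n.+1%:R.
have N0 : N != 0 by rewrite pnatr_eq0.
have Npos : 0 < N by rewrite ltr0n.
have sumc (v : R) : \sum_(i < n.+1) v = v * N.
  by rewrite sumr_const card_ord mulr_natr.
pose u : 'I_n.+1 -> R := fun=> N^-1.
have u1 : \sum_i u i = 1 by rewrite sumc mulVf.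
have hu i : 0 <= head_sum u i by apply: sumr_ge0 => j _; rewrite invr_ge0 ltW.
have tu i : 0 <= tail_sum u i by apply: sumr_ge0 => j _; rewrite invr_ge0 ltW.
have uxE : \sum_i u i * x i = (\sum_i x i) / N by rewrite -mulr_sumr mulrC.
have pab := mean_itv xab hxs hp0 tp0 hp1.
have uab := mean_itv xab hxs hu tu u1.
rewrite uxE in uab.
(* In the lower bound m* is the weight of the additional atom. *)
have m0 : 0 <= mstar p.
  by apply: le_mstar => i; rewrite ler_ratio ?tail_size_gt0 // !mul0r subr0.
have affE (s v : R) (F : 'I_n.+1 -> R) :
    \sum_i (s * p i - v) * F i = s * \sum_i p i * F i - v * \sum_i F i.
  by rewrite !mulr_sumr -sumrB; apply: eq_bigr => i _; rewrite mulrBl mulrA.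
have aff1 (s v : R) : \sum_i (s * p i - v) = s - v * N.
  by rewrite sumrB -mulr_sumr hp1 mulr1 sumc.
have lower : mstar p * unif_jensen f x <= jensen f x p.
  (* [erefl] takes as [W] the mass as it stands, which simplifies to 1 here and to M* in the upper
     bound; [field] then checks the barycentre. *)
  have := signed_jensen fab xab pab uab hxs
    (head_sub_mstar_ge0 p) (tail_sub_mstar_ge0 p) m0 (erefl _).
  rewrite !affE aff1 -/N divfK // subrK => /(_ _)/wrap[].
    by field.
  by rewrite /jensen /unif_jensen -mulr_suml -/N; clearbody N; lra.
have upper : jensen f x p <= Mstar p * unif_jensen f x.
  have := signed_jensen fab xab uab pab hxs
    (head_Mstar_sub_ge0 p) (tail_Mstar_sub_ge0 p) ler01 (erefl _).
  rewrite !affE aff1 -/N !mulNr divfK // !opprK addrAC addNr add0r => /(_ _)/wrap[].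
    by field.
  by rewrite /jensen /unif_jensen -mulr_suml -/N; clearbody N; lra.
split=> // p0; rewrite unif_jensenE.
(* Equal weights and [w = 0]: the additional atom carries no mass. *)
have J0 : 0 <= unif_jensen f x.
  have := signed_jensen fab xab uab uab hxs hu tu (lexx 0) (erefl _).
  rewrite u1 !mul0r !addr0 uxE !mul1r => /(_ erefl).
  by rewrite -mulr_sumr /unif_jensen -mulr_suml subr_ge0 [_^-1 * _]mulrC.
(* By [J0] it remains to show N min p <= m* and M* <= N max p; these hold because p - min p and max
   p - p are termwise nonnegative. *)
split=> //; rewrite mulrA ler_wpM2r //.
  have sub0 i : 0 <= 1 * p i - fam_min p by rewrite mul1r subr_ge0 fam_min_le.
  apply: le_mstar => i; rewrite ler_ratio ?tail_size_gt0 // mulfK //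
    -[X in X - _]mul1r.
    by rewrite -head_sum_affine sumr_ge0.
  by rewrite -tail_sum_affine sumr_ge0.
have sub0 i : 0 <= -1 * p i - - fam_max p.
  by rewrite mulN1r opprK addrC subr_ge0 le_fam_max.
apply: Mstar_le => i; rewrite ger_ratio ?tail_size_gt0 // mulfK // addrC -mulN1r
  -[X in _ + X]opprK -mulNr.
  by rewrite -head_sum_affine sumr_ge0.
by rewrite -tail_sum_affine sumr_ge0.
Qed.
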